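(* Let $R$ be a $\mathbb C^{p\times p}$-valued rational function, analytic at infinity, strictly positive on the unit circle and with no poles there. Let $w(\lambda)=d+c(\lambda I_\ell-a)^{-1}b$ be a minimal realization of the left spectral factor $w$ of $R$, with $a$ invertible. Let $X$ be the unique solution of the Stein equation $X-aXa^*=bb^*$, and let $$f(m,0)=\frac{1}{2\pi}\int_0^{2\pi}(\sqrt2e^{-it}-i)^mR(e^{it})\,dt,\qquad m=0,1,\ldots$$ Then $$f(m,0)=(-i)^md(d^*-b^*a^{-*}c^* )+(db^*a^{-*}+cX)(\sqrt{2}a^*-iI_{\ell})^mc^*,\qquad m=0,1,\ldots$$ In particular, for $d=0$, $$f(m,0)=cX(\sqrt{2}a^*-iI_{\ell})^mc^*,\qquad m=0,1,\ldots,$$ and for $d=ca^{-1}b$, $$f(m,0)=c(Xa^{-*}+a^{-1}X)(\sqrt{2}a^*-iI_{\ell})^mc^*,\qquad m=0,1,\ldots$$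
   Context: A left spectral factor of $R$ is a $\mathbb C^{p\times p}$-valued rational function $w$, analytic at infinity, such that $R(\lambda)=w(\lambda)\,(w(1/\overline\lambda))^*$ and both $w$ and $w^{-1}$ are analytic in $\{1<|\lambda|<\infty\}$; it is unique up to multiplication on the right by a unitary matrix. The spectrum of $a$ then lies in the open unit disk. A realization $w(\lambda)=d+c(\lambda I_\ell-a)^{-1}b$ is minimal if the size $\ell$ of the matrix $a$ is the smallest possible. The notation $a^{-*}$ means $(a^* )^{-1}$. The numbers (matrices) $f(m,0)$ are the boundary values of the discrete analytic function $f(m,n)=\frac1{2\pi}\int_0^{2\pi}(\sqrt2e^{-it}-i)^m(\sqrt2e^{it}+i)^nR(e^{it})\,dt$, $m,n=0,1,\ldots$, with spectral density $R$; discrete analytic means $f(m,n)+if(m+1,n)-if(m,n+1)-f(m+1,n+1)=0$ for all $m,n\ge 0$.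
   Formalization: The printed last formula, for d = ca^{-1}b, is false (e.g. p = ℓ = 1, a = 1/4, b = c = 1, d = 4); the formal statement has the coefficient c a^{-1}Xa^{-*} in place of c(Xa^{-*}+a^{-1}X). *)

(* Defs.v *)
From HB Require Import structures.
From mathcomp Require Import all_boot all_order all_algebra.
From mathcomp Require Import fraction spectral complex.
From mathcomp Require Import all_classical all_reals all_analysis.

Set Implicit Arguments.
Unset Strict Implicit.
Unset Printing Implicit Defensive.

Import Order.TTheory GRing.Theory Num.Theory.
Local Open Scope ring_scope.
Local Open Scope complex_scope.
Local Open Scope sesquilinear_scope.

Notation "x %:F" := (@FracField.tofrac _ x) : ring_scope.

(* Scalar rational functions over C are elements of the field of fractions
   C(X) of {poly C}, and matrix-valued ones are matrices over that field.
   Values and poles are read off from the fraction in lowest terms, so that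
   removable singularities are removed. *)
Notation ratfun C := {fraction {poly C}}.

Section RationalFunctions.
Variable C : fieldType.
Implicit Types (f : ratfun C) (z : C).

Definition rf_gcd f : {poly C} := gcdp (frac (repr f)).1 (frac (repr f)).2.
Definition rf_num f : {poly C} := (frac (repr f)).1 %/ rf_gcd f.
Definition rf_den f : {poly C} := (frac (repr f)).2 %/ rf_gcd f.

Definition rf_analytic f z : bool := ~~ root (rf_den f) z.
Definition rf_eval f z : C := (rf_num f).[z] / (rf_den f).[z].

Definition rf_const (c : C) : ratfun C := (c%:P)%:F.

(* The substitution lambda |-> f(1/lambda). *)
Definition rf_swap f : ratfun C :=
  (map_poly rf_const (rf_num f)).[('X%:F)^-1]
  / (map_poly rf_const (rf_den f)).[('X%:F)^-1].
Definition rf_analytic_infty f : bool := rf_analytic (rf_swap f) 0.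

Definition mx_analytic m n (w : 'M[ratfun C]_(m, n)) z : Prop :=
  forall i j, rf_analytic (w i j) z.
Definition mx_analytic_infty m n (w : 'M[ratfun C]_(m, n)) : Prop :=
  forall i j, rf_analytic_infty (w i j).
Definition mx_eval m n (w : 'M[ratfun C]_(m, n)) z : 'M[C]_(m, n) :=
  map_mx (rf_eval^~ z) w.

(* The equality is one of rational functions; 'X - a is invertible over C(X)
   because its determinant is the characteristic polynomial of a. *)
Definition realization p l (w : 'M[ratfun C]_p) (a : 'M[C]_l)
    (b : 'M[C]_(l, p)) (c : 'M[C]_(p, l)) (d : 'M[C]_p) : Prop :=
  w = map_mx rf_const d
      + map_mx rf_const c *m invmx (('X%:F)%:M - map_mx rf_const a)
        *m map_mx rf_const b.

Definition minimal_realization p l (w : 'M[ratfun C]_p) (a : 'M[C]_l)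
    (b : 'M[C]_(l, p)) (c : 'M[C]_(p, l)) (d : 'M[C]_p) : Prop :=
  realization w a b c d /\
  forall l' (a' : 'M[C]_l') (b' : 'M[C]_(l', p)) (c' : 'M[C]_(p, l'))
    (d' : 'M[C]_p), realization w a' b' c' d' -> (l <= l')%N.

Lemma rf_gcd_neq0 f : rf_gcd f != 0.
Proof. by rewrite gcdp_eq0 negb_and denom_ratioP orbT. Qed.

Lemma rf_den_neq0 f : rf_den f != 0.
Proof.
have := denom_ratioP (repr f).
by rewrite -{1}[(frac (repr f)).2](divpK (dvdp_gcdr (frac (repr f)).1 _))
  mulf_eq0 negb_or => /andP[].
Qed.

Lemma rf_coprime f : coprimep (rf_num f) (rf_den f).
Proof. by rewrite /coprimep; apply: coprimep_div_gcd; rewrite denom_ratioP orbT. Qed.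

Lemma rf_numden f : f = (rf_num f)%:F / (rf_den f)%:F.
Proof.
set n := (frac (repr f)).1; set d := (frac (repr f)).2.
have d0 : d != 0 by exact: denom_ratioP.
have nE : rf_num f * rf_gcd f = n by rewrite divpK // dvdp_gcdl.
have dE : rf_den f * rf_gcd f = d by rewrite divpK // dvdp_gcdr.
have fE : f * d%:F = n%:F.
  rewrite -[f]reprK !piE; apply/eqP.
  rewrite FracField.equivf_def /FracField.mulf.
  rewrite !numden_Ratio ?mulr1 ?oner_neq0 //.
  by rewrite mulrC.
have g0 : (rf_gcd f)%:F != 0 :> ratfun C by rewrite tofrac_eq0 rf_gcd_neq0.
have e0 : (rf_den f)%:F != 0 :> ratfun C by rewrite tofrac_eq0 rf_den_neq0.
apply: (mulIf e0); rewrite divfK //; apply: (mulIf g0).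
by rewrite -mulrA -!tofracM nE dE.
Qed.

Lemma rf_evalE (n d : {poly C}) z : d.[z] != 0 ->
  rf_analytic (n%:F / d%:F) z /\ rf_eval (n%:F / d%:F) z = n.[z] / d.[z].
Proof.
move=> dz; have d0 : d != 0 by apply: contraNneq dz => ->; rewrite horner0.
set f := _ / _; have e0 := rf_den_neq0 f.
have nd : n * rf_den f = rf_num f * d.
  apply/eqP; rewrite -(tofrac_eq (n * _)) !tofracM; apply/eqP.
  have := rf_numden f; rewrite {1}/f => /eqP.
  by rewrite eqr_div ?tofrac_eq0 // => /eqP.
have dvd : rf_den f %| d.
  rewrite -(@Gauss_dvdpr _ _ (rf_num f)) 1?coprimep_sym ?rf_coprime //.
  by rewrite -nd dvdp_mull.
have ez : (rf_den f).[z] != 0.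
  by apply: contraNneq dz => ez; rewrite -(divpK dvd) hornerM ez mulr0.
split; first by [].
by apply/eqP; rewrite /rf_eval eqr_div // -!hornerM nd.
Qed.

End RationalFunctions.

Section SpectralFactor.
Variable K : realType.
Local Notation C := K[i].

Definition posdefmx p (A : 'M[C]_p) : Prop :=
  A^t* = A /\ forall v : 'cV[C]_p, v != 0 -> 0 < (v^t* *m A *m v) 0 0.

(* The factorization R(z) = w(z) w(1 / conj z)^* of rational functions is
   required wherever both sides are defined. *)
Definition left_spectral_factor p (R w : 'M[ratfun C]_p) : Prop :=
  [/\ mx_analytic_infty w,
      w \in unitmx,
      forall z : C, 1 < `|z| -> mx_analytic w z /\ mx_analytic (invmx w) z
    & forall z : C, z != 0 -> mx_analytic R z -> mx_analytic w z ->
        mx_analytic w (z^*)^-1 ->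
        mx_eval R z = mx_eval w z *m (mx_eval w (z^*)^-1)^t* ].

Definition cexpi (t : K) : C := cos t +i* sin t.

Definition cintegral (s t : K) (f : K -> C) : C :=
  (\int[lebesgue_measure]_(x in `[s, t]) complex.Re (f x))
  +i* (\int[lebesgue_measure]_(x in `[s, t]) complex.Im (f x)).

Definition boundary_value p (R : 'M[ratfun C]_p) (m : nat) : 'M[C]_p :=
  \matrix_(j, k) (((2 * pi)^-1)%:C *
    cintegral 0 (2 * pi) (fun t =>
      ((Num.sqrt 2)%:C * cexpi (- t) - 'i) ^+ m * mx_eval R (cexpi t) j k)).

Definition stein_solution p l (a : 'M[C]_l) (b : 'M[C]_(l, p)) (X : 'M[C]_l)
    : Prop :=
  X - a *m X *m a^t* = b *m b^t*.

End SpectralFactor.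

(* Main.v *)
From HB Require Import structures.
Require Import Defs.
From mathcomp Require Import all_boot all_order all_algebra.
From mathcomp Require Import fraction spectral complex.
From mathcomp Require Import all_classical all_reals all_analysis.
From mathcomp Require Import ring.

(** On the unit circle R = w w^*, and w = d + c G b with G(z) = (z - a)^-1.
    The Stein equation turns the product of the two resolvents in w w^* into a
    sum of terms with one resolvent each (circle_spectral_identity):
      R = d d^* + c X c^* + (d b^* + c X a^* ) G^* c^*
          + c G (b d^* + a X c^* ).
    The boundary value f(m,0) is the mean over the circle of s^m R, where
    s = sqrt2 zeta - i is affine in zeta = 1/z. So the three terms reduce to three
    means: that of s^m is (-i)^m; that of s^m G is 0
    (mxmean_affine_resolvent); and that of s^m G^* is
    (V^m - (-i)^m) a^-*, by induction on m from zeta G^* = 1 + a^* G^*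
    (mxmean_affine_resolvent_adj). Adding them up is the general formula, and
    the two special cases follow from it by the Stein equation.

    All this needs the spectrum of a to lie in the open unit disk, for the
    existence and uniqueness of X (stein_unique_solution) and for the mean of
    zeta^k G to vanish. The latter is proved without expanding G in powers of a:
    z G = 1 + a G says that these means H k satisfy H k = a H (k+1), and they are
    bounded, which for a stable a forces them to be 0 (bounded_backward_orbit).

    The location of the spectrum has two ingredients. By minimality, w has a
    pole at each eigenvalue of a: otherwise splitting off the generalized
    eigenspace would give a smaller realization (minimal_realization_pole). And
    w has no pole of modulus at least 1: outside the closed disk this is part
    of being a left spectral factor, and on the circle the rows of w are bounded
    by the diagonal of R (spectral_factor_circle). *)

Set Implicit Arguments.
Unset Strict Implicit.
Unset Printing Implicit Defensive.

Import Order.TTheory GRing.Theory Num.Theory numFieldNormedType.Exports.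
Local Open Scope ring_scope.
Local Open Scope complex_scope.
Local Open Scope sesquilinear_scope.

(** * Poles of rational functions and minimal realizations *)

Section Evaluation.
Variable F : fieldType.
Implicit Types (f g : ratfun F) (z : F).

Lemma tofrac_horner_neq0 (e : {poly F}) z : e.[z] != 0 -> e%:F != 0.
Proof.
by move=> ez; rewrite tofrac_eq0; apply: contraNneq ez => ->; rewrite horner0.
Qed.

Lemma rf_analyticP f z :
  reflect (exists n e : {poly F}, e.[z] != 0 /\ f = n%:F / e%:F)
          (rf_analytic f z).
Proof.
apply: (iffP idP) => [fz | [n [e [ez ->]]]]; last by have [] := rf_evalE n ez.
by exists (rf_num f), (rf_den f); split=> //; apply: rf_numden.
Qed.

Lemma rf_analyticD f g z : rf_analytic f z -> rf_analytic g z ->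
  rf_analytic (f + g) z /\ rf_eval (f + g) z = rf_eval f z + rf_eval g z.
Proof.
move=> /rf_analyticP[n [e [ez ->]]] /rf_analyticP[m [h [hz ->]]].
have e0 : e%:F != 0 := tofrac_horner_neq0 ez.
have h0 : h%:F != 0 := tofrac_horner_neq0 hz.
have ehz : (e * h).[z] != 0 by rewrite hornerM mulf_neq0.
rewrite (rf_evalE n ez).2 (rf_evalE m hz).2.
rewrite (addf_div _ _ e0 h0).
rewrite -(tofracM n h) -(tofracM m e) -(tofracM e h) -tofracD.
have [? ->] := rf_evalE (n * h + m * e) ehz; split=> //.
by rewrite hornerD !hornerM addf_div.
Qed.

Lemma rf_analyticM f g z : rf_analytic f z -> rf_analytic g z ->
  rf_analytic (f * g) z /\ rf_eval (f * g) z = rf_eval f z * rf_eval g z.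
Proof.
move=> /rf_analyticP[n [e [ez ->]]] /rf_analyticP[m [h [hz ->]]].
have ehz : (e * h).[z] != 0 by rewrite hornerM mulf_neq0.
rewrite (rf_evalE n ez).2 (rf_evalE m hz).2 !mulf_div -(tofracM n m) -(tofracM e h).
have [? ->] := rf_evalE (n * m) ehz; split=> //.
by rewrite !hornerM.
Qed.

Lemma rf_analytic_poly (n : {poly F}) z :
  rf_analytic n%:F z /\ rf_eval n%:F z = n.[z].
Proof.
have := @rf_evalE _ n 1 z; rewrite hornerC => /(_ (oner_neq0 _)).
by rewrite tofrac1 !divr1.
Qed.

Lemma rf_analytic_sum (I : finType) (f : I -> ratfun F) z :
  (forall i, rf_analytic (f i) z) ->
  rf_analytic (\sum_i f i) z /\
  rf_eval (\sum_i f i) z = \sum_i rf_eval (f i) z.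
Proof.
move=> fz; apply: (big_ind2 (fun g x => rf_analytic g z /\ rf_eval g z = x)).
- by have := rf_analytic_poly 0 z; rewrite tofrac0 horner0.
- by move=> g1 x1 g2 x2 [g1z <-] [g2z <-]; apply: rf_analyticD.
- by move=> i _; split.
Qed.

Fact rf_const_is_zmod : zmod_morphism (@rf_const F).
Proof. by move=> x y; rewrite /rf_const polyCB tofracB. Qed.

Fact rf_const_is_monoid : monoid_morphism (@rf_const F).
Proof. by split=> [|x y]; rewrite /rf_const ?polyC1 ?tofrac1 // polyCM tofracM. Qed.

HB.instance Definition _ :=
  GRing.isZmodMorphism.Build F (ratfun F) (@rf_const F) rf_const_is_zmod.
HB.instance Definition _ :=
  GRing.isMonoidMorphism.Build F (ratfun F) (@rf_const F) rf_const_is_monoid.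

Lemma mx_analytic_const m n (A : 'M[F]_(m, n)) z :
  mx_analytic (map_mx (@rf_const F) A) z /\
  mx_eval (map_mx (@rf_const F) A) z = A.
Proof.
split=> [i j|]; first by rewrite mxE; case: (rf_analytic_poly (A i j)%:P z).
by apply/matrixP=> i j; rewrite !mxE (rf_analytic_poly (A i j)%:P z).2 hornerC.
Qed.

Lemma mx_analyticD m n (A B : 'M[ratfun F]_(m, n)) z :
  mx_analytic A z -> mx_analytic B z ->
  mx_analytic (A + B) z /\ mx_eval (A + B) z = mx_eval A z + mx_eval B z.
Proof.
move=> Az Bz; split=> [i j|].
  by rewrite mxE; case: (rf_analyticD (Az i j) (Bz i j)).
by apply/matrixP=> i j; rewrite !mxE; case: (rf_analyticD (Az i j) (Bz i j)).
Qed.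

Lemma mx_analyticM m n p (A : 'M[ratfun F]_(m, n)) (B : 'M[ratfun F]_(n, p)) z :
  mx_analytic A z -> mx_analytic B z ->
  mx_analytic (A *m B) z /\ mx_eval (A *m B) z = mx_eval A z *m mx_eval B z.
Proof.
move=> Az Bz.
have ABz i j k : rf_analytic (A i k * B k j) z /\ _ := rf_analyticM (Az i k) (Bz k j).
split=> [i j|].
  by rewrite mxE; apply: (rf_analytic_sum _).1 => k; case: (ABz i j k).
apply/matrixP=> i j; rewrite !mxE (rf_analytic_sum _).2 => [|k].
  by apply: eq_bigr => k _; rewrite !mxE; case: (ABz i j k).
by case: (ABz i j k).
Qed.

Definition resolvent l (a : 'M[F]_l) : 'M[ratfun F]_l :=
  invmx (('X%:F)%:M - map_mx (@rf_const F) a).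

Lemma resolvent_denom l (a : 'M[F]_l) :
  ('X%:F)%:M - map_mx (@rf_const F) a = map_mx (@FracField.tofrac _) (char_poly_mx a).
Proof.
by apply/matrixP=> i j; rewrite !mxE rmorphB rmorphMn.
Qed.

Lemma resolvent_unit l (a : 'M[F]_l) :
  ('X%:F)%:M - map_mx (@rf_const F) a \in unitmx.
Proof.
rewrite resolvent_denom unitmxE det_map_mx unitfE tofrac_eq0.
exact: monic_neq0 (char_poly_monic a).
Qed.

Lemma mx_analytic_resolvent l (a : 'M[F]_l) z : ~~ root (char_poly a) z ->
  [/\ mx_analytic (resolvent a) z, z%:M - a \in unitmx
    & mx_eval (resolvent a) z = invmx (z%:M - a)].
Proof.
move=> az.
have rz : mx_analytic (resolvent a) z.
  move=> i j; rewrite /resolvent /invmx resolvent_unit mxE mulrC.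
  rewrite resolvent_denom det_map_mx -map_mx_adj mxE.
  by apply/rf_analyticP; exists (\adj (char_poly_mx a) i j), (char_poly a).
have Xz : mx_analytic (('X%:F)%:M - map_mx (@rf_const F) a) z /\
    mx_eval (('X%:F)%:M - map_mx (@rf_const F) a) z = z%:M - a.
  rewrite resolvent_denom; split=> [i j|].
    by rewrite mxE; case: (rf_analytic_poly (char_poly_mx a i j) z).
  apply/matrixP=> i j; rewrite !mxE (rf_analytic_poly _ z).2.
  by rewrite !hornerE hornerMn hornerX.
have I1 : mx_eval (1%:M : 'M[ratfun F]_l) z = 1%:M.
  by have := (mx_analytic_const (1%:M : 'M[F]_l) z).2; rewrite map_mx1.
have := (mx_analyticM Xz.1 rz).2.
rewrite mulmxV ?resolvent_unit // I1 Xz.2 => /esym e1.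
have [u1 u2] := mulmx1_unit e1; split=> //.
by apply: (row_full_inj (A := z%:M - a)); rewrite ?row_full_unit // e1 mulmxV.
Qed.

(** The numerator n of (X-z)^k g is divisible by (X-z)^k, since g is analytic at
    z, and has degree less than k. *)
Lemma analytic_principal_part (g : ratfun F) (n : {poly F}) z k :
  rf_analytic g z -> (('X - z%:P) ^+ k)%:F * g = n%:F -> (size n <= k)%N ->
  g = 0.
Proof.
move=> /rf_analyticP[m [e [ez ->]]] En sn.
have e0 : e%:F != 0 := tofrac_horner_neq0 ez.
have x0 : (('X - z%:P) ^+ k)%:F != 0.
  by rewrite tofrac_eq0 expf_neq0 // polyXsubC_eq0.
set y := ('X - z%:P) ^+ k in x0 *.
have : y * m = n * e.
  apply/eqP; rewrite -(tofrac_eq (y * m)) (tofracM y m) (tofracM n e) -En.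
  by move: (y%:F) (m%:F) (e%:F) e0 => y' m' e' e0; rewrite -mulrA divfK.
move=> Em; have ye : coprimep y e.
  by rewrite coprimep_expl // coprimep_sym coprimep_XsubC.
have : y %| n by rewrite -(Gauss_dvdpl _ ye) -Em dvdp_mulr.
have [n0|n0 /(dvdp_leq n0)] := eqVneq n 0; last first.
  by rewrite size_exp_XsubC ltnNge sn.
move: En; rewrite n0 tofrac0 => /eqP; rewrite mulf_eq0 (negPf x0) /= => /eqP.
by [].
Qed.

(** The rank is named r so that P can be rewritten without changing the type of
    the factors. *)
Lemma idempotent_factor n (P : 'M[F]_n) : P *m P = P ->
  exists r (C : 'M[F]_(n, r)) (R : 'M[F]_(r, n)),
    [/\ r = \rank P, C *m R = P & R *m C = 1%:M].
Proof.
move=> PP; exists (\rank P), (col_base P), (row_base P).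
have := mulmx_base P; move: (col_base_full P) (row_base_free P).
move: (col_base P) (row_base P) => C R Cfull Rfree CR; split=> //.
apply: (row_free_inj Rfree); apply: (row_full_inj Cfull).
by rewrite /= mul1mx -mulmxA (mulmxA C) CR PP.
Qed.

(** Split the state space as im P + im Q, with P and Q = 1 - P polynomials in a,
    so that z is no eigenvalue of a on im P and a - z is nilpotent on im Q. The
    part of w carried by im Q is a principal part at z, hence 0 if w is analytic
    there; then im P alone realizes w, and minimality forces im Q = 0. *)
Lemma minimal_realization_pole p l (w : 'M[ratfun F]_p) (a : 'M[F]_l)
    (b : 'M[F]_(l, p)) (c : 'M[F]_(p, l)) (d : 'M[F]_p) z :
  minimal_realization w a b c d -> mx_analytic w z -> ~~ root (char_poly a) z.
Proof.
case: l a b c => [|l] a b c [real_w min_w] wz.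
  by rewrite /char_poly det_mx00 root1.
apply/negP=> az.
pose x : ratfun F := ('X - z%:P)%:F; pose rc := @rf_const F.
have [k [q qz chiE]] := multiplicity_XsubC (char_poly a) z.
rewrite monic_neq0 ?char_poly_monic //= in qz.
have k_gt0 : (0 < k)%N.
  by case: k chiE => // chiE; move: az; rewrite chiE mulr1 (negPf qz).
have /Bezout_eq1_coprimepP[[u v] /= uv1] : coprimep q (('X - z%:P) ^+ k).
  by rewrite coprimep_expr // coprimep_XsubC.
pose N := a - z%:M.
have NE : horner_mx a ('X - z%:P) = N by rewrite rmorphB /= horner_mx_X horner_mx_C.
pose P := horner_mx a (('X - z%:P) ^+ k * v); pose Q := horner_mx a (u * q).
have PQ1 : P + Q = 1 by rewrite -rmorphD /= addrC [_ ^+ k * v]mulrC uv1 rmorph1.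
have NkQ : N ^+ k * Q = 0.
  rewrite -NE -rmorphXn /= -rmorphM /= mulrCA [_ * q]mulrC -chiE.
  by rewrite rmorphM /= Cayley_Hamilton mulr0.
have PQ0 : P * Q = 0.
  by rewrite /P [_ * v]mulrC rmorphM /= -mulrA rmorphXn /= NE NkQ mulr0.
have PP : P *m P = P by rewrite -[RHS]mulr1 -PQ1 mulrDr PQ0 addr0.
have aP : a *m P = P *m a by apply: comm_mx_horner.
have [r [Cb [Rb [rP CR RC]]]] := idempotent_factor PP.
(* a1 is the action of a on im P, in coordinates given by Cb and Rb. *)
pose a1 := Rb *m a *m Cb.
have aCb : a *m Cb = Cb *m a1.
  by rewrite /a1 !mulmxA CR -aP -CR -!mulmxA RC mulmx1.
have Rba : Rb *m a = a1 *m Rb.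
  by rewrite /a1 -!mulmxA CR aP -CR !mulmxA RC mul1mx.
(* P is a multiple of (a - z)^k and k > 0. *)
have eigP (y : 'rV_l.+1) : y *m N = 0 -> y *m P = 0.
  move=> yN; rewrite /P rmorphM /= rmorphXn /= NE -(prednK k_gt0) exprS.
  by rewrite -mulrA [N * _]/(N *m _) mulmxA yN mul0mx.
have a1z : ~~ root (char_poly a1) z.
  rewrite -eigenvalue_root_char; apply/eigenvalueP => -[y ya1 y0].
  have /eigP : y *m Rb *m N = 0.
    by rewrite mulmxBr -mulmxA Rba mulmxA ya1 mul_mx_scalar scalemxAl subrr.
  rewrite -CR -!mulmxA (mulmxA Rb) RC mul1mx => yR.
  by case/eqP: y0; rewrite -[y]mulmx1 -RC mulmxA yR mul0mx.
pose E := ('X%:F)%:M - map_mx rc a.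
have ECb : resolvent a *m map_mx rc Cb = map_mx rc Cb *m resolvent a1.
  apply: (row_full_inj (A := E)); first by rewrite row_full_unit resolvent_unit.
  rewrite /= mulmxA mulmxV ?resolvent_unit // mul1mx mulmxA.
  rewrite mulmxBl -map_mxM aCb map_mxM mul_scalar_mx -mul_mx_scalar -mulmxBr.
  by rewrite -mulmxA mulmxV ?resolvent_unit // mulmx1.
have wE : w = map_mx rc d + map_mx rc (c *m Cb) *m resolvent a1 *m map_mx rc (Rb *m b)
   + map_mx rc c *m resolvent a *m map_mx rc (Q *m b).
  rewrite [LHS]real_w -[in LHS](mul1mx b) -[1%:M]PQ1 -CR mulmxDl -/rc map_mxD mulmxDr.
  rewrite addrA -/(resolvent a); congr (_ + _ + _).
  by rewrite !map_mxM -!mulmxA (mulmxA (resolvent a)) ECb !mulmxA.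
set G := _ *m map_mx rc (Q *m b) in wE.
have Gz : mx_analytic G z.
  have -> : G = w + map_mx rc (-1)%:M *m
      (map_mx rc d + map_mx rc (c *m Cb) *m resolvent a1 *m map_mx rc (Rb *m b)).
    by rewrite wE map_scalar_mx rmorphN1 mul_scalar_mx scaleN1r [_ + G]addrC addrK.
  have [ra1z _ _] := mx_analytic_resolvent a1z.
  apply: (mx_analyticD wz _).1; apply: (mx_analyticM (mx_analytic_const _ _).1 _).1.
  apply: (mx_analyticD (mx_analytic_const _ _).1 _).1.
  apply: (mx_analyticM _ (mx_analytic_const _ _).1).1.
  exact: (mx_analyticM (mx_analytic_const _ _).1 _).1.
(* (a - z)^k Q = 0, so the resolvent on im Q is a finite geometric sum. *)
have xG : x ^+ k *: G =
    \sum_(i < k) x ^+ (k.-1 - i) *: map_mx rc (c *m N ^+ i *m Q *m b).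
  have xQ : x ^+ k *: (resolvent a *m map_mx rc Q) =
     \sum_(i < k) x ^+ (k.-1 - i) *: map_mx rc (N ^+ i *m Q).
    apply: (row_full_inj (A := E)); first by rewrite row_full_unit resolvent_unit.
    rewrite /= -scalemxAr mulmxA mulmxV ?resolvent_unit // mul1mx.
    have EE : E = x%:M - map_mx rc N.
      rewrite /E /x /N tofracB map_mxB map_scalar_mx raddfB /= /rc /rf_const.
      by rewrite opprB addrA subrK.
    have xN : GRing.comm (x%:M : 'M[ratfun F]_l.+1) (map_mx rc N).
      by rewrite /GRing.comm; symmetry; exact: (scalar_mxC x (map_mx rc N)).
    have XE : x ^+ k *: 1%:M - map_mx rc (N ^+ k) =
        E *m \sum_(i < k) x ^+ (k.-1 - i) *: map_mx rc (N ^+ i).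
      rewrite scalemx1 [(x ^+ k)%:M]rmorphXn [map_mx rc (N ^+ k)]rmorphXn /=.
      rewrite subrXX_comm // -EE; congr (_ * _); apply: eq_bigr => i _.
      by rewrite -rmorphXn /= [map_mx rc (N ^+ i)]rmorphXn /= -mul_scalar_mx.
    have := congr1 (mulmx^~ (map_mx rc Q)) XE.
    rewrite /= mulmxBl -map_mxM [N ^+ k *m Q]NkQ map_mx0 subr0 -scalemxAl mul1mx => ->.
    rewrite -mulmxA mulmx_suml; congr (_ *m _); apply: eq_bigr => i _.
    by rewrite -scalemxAl map_mxM.
  rewrite /G map_mxM -!mulmxA (mulmxA (resolvent a)) scalemxAr scalemxAl xQ.
  rewrite mulmx_suml mulmx_sumr; apply: eq_bigr => i _.
  by rewrite -scalemxAl -scalemxAr !map_mxM !mulmxA.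
have G0 : G = 0.
  apply/matrixP => i j; rewrite [RHS]mxE.
  pose m (t : 'I_k) := (c *m N ^+ t *m Q *m b) i j.
  pose n := \sum_(t < k) m t *: ('X - z%:P) ^+ (k.-1 - t).
  apply: (@analytic_principal_part _ n z k); first exact: Gz.
    transitivity ((x ^+ k *: G) i j); first by rewrite [RHS]mxE /x -tofracXn.
    rewrite xG summxE raddf_sum; apply: eq_bigr => t _.
    rewrite mxE [map_mx _ _ i j]mxE -/(m t) /x /rc /rf_const -tofracXn.
    by rewrite -mul_polyC [LHS]mulrC; symmetry; exact: (tofracM (m t)%:P).
  apply: (leq_trans (size_sum _ _ _)); apply/bigmax_leqP => t _.
  apply: (leq_trans (size_scale_leq _ _)); rewrite size_exp_XsubC.
  by rewrite (leq_ltn_trans (leq_subr _ _)) // ltn_predL.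
have /min_w : realization w a1 (Rb *m b) (c *m Cb) d.
  by rewrite /realization -/(resolvent a1) [LHS]wE G0 addr0.
rewrite rP => rankP.
have Pfree : row_free P by rewrite /row_free eqn_leq rankP rank_leq_row.
move: az; rewrite -eigenvalue_root_char => /eigenvalueP[y ya y0].
have /eqP : y *m P = 0.
  by apply: eigP; rewrite mulmxBr ya mul_mx_scalar subrr.
by rewrite mulmx_free_eq0 // (negPf y0).
Qed.

End Evaluation.

(** * Stable matrices and the Stein equation *)

Section EigenMatrices.

Lemma root_char_poly_eigen (F : fieldType) l n (a : 'M[F]_l) (v : 'M[F]_(l, n)) r :
  a *m v = r *: v -> v != 0 -> root (char_poly a) r.
Proof.
move=> av v0; apply: contraNT v0 => ar.
have a_u : a - r%:M \in unitmx.
  rewrite -row_free_unit -kermx_eq0; apply: contraNT ar => ar.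
  by rewrite -eigenvalue_root_char.
apply/eqP; apply: (row_full_inj (A := a - r%:M)); rewrite ?row_full_unit //=.
by rewrite mulmx0 mulmxBl av mul_scalar_mx subrr.
Qed.

(** As the characteristic polynomial splits, applying its linear factors to u
    one at a time stays in S and reaches 0; the last nonzero matrix is an
    eigenmatrix. *)
Lemma stable_has_eigenmatrix (F : closedFieldType) l n (a : 'M[F]_l)
    (S : 'M[F]_(l, n) -> Prop) u :
  (forall r v, S v -> S (a *m v - r *: v)) -> S u -> u != 0 ->
  exists r v, [/\ S v, v != 0 & a *m v = r *: v].
Proof.
case: l a S u => [|l] a S u stS Su u0.
  by case/eqP: u0; apply/matrixP => -[].
have [rs] := closed_field_poly_normal (char_poly a).
rewrite (monicP (char_poly_monic a)) scale1r => chiE.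
have : horner_mx a (\prod_(z <- rs) ('X - z%:P)) *m u = 0.
  by rewrite -chiE Cayley_Hamilton mul0mx.
elim: rs {chiE} u Su u0 => [|z rs IH] u Su u0.
  by rewrite big_nil rmorph1 mul1mx => /eqP; rewrite (negPf u0).
rewrite big_cons mulrC rmorphM /= -mulmxA rmorphB /= horner_mx_X horner_mx_C.
rewrite [(a - _) *m u]mulmxBl mul_scalar_mx.
have [/eqP au _|au] := eqVneq (a *m u - z *: u) 0; last by apply: IH; first exact: stS.
by exists z, u; split=> //; apply/eqP; rewrite -subr_eq0.
Qed.

Definition schur_stable (F : numClosedFieldType) l (a : 'M[F]_l) :=
  forall r, root (char_poly a) r -> `|r| < 1.

(** The solutions form a space stable under a. An eigenmatrix v in it, with
    eigenvalue r, satisfies v = r v a^*, so 1 / r^* is an eigenvalue of a too;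
    but r and 1 / r^* cannot both lie in the open disk. *)
Lemma stein_homogeneous (F : numClosedFieldType) l (a Y : 'M[F]_l) :
  a \in unitmx -> schur_stable a -> Y = a *m Y *m a^t* -> Y = 0.
Proof.
move=> a_u a_st YE; apply/eqP/negPn/negP => Y0.
pose S (Z : 'M[F]_l) := Z = a *m Z *m a^t*.
have [|r [v [Sv v0 av]]] := @stable_has_eigenmatrix _ _ _ a S Y _ YE Y0.
  move=> r v Sv; have e : a *m (a *m v) *m a^t* = a *m v by rewrite -mulmxA -Sv.
  by rewrite /S mulmxBr mulmxBl -scalemxAr -scalemxAl e -Sv.
have r1 := a_st _ (root_char_poly_eigen av v0).
have r0 : r != 0.
  apply: contraNneq v0 => r0; rewrite -[v](mulKmx a_u) av r0 scale0r mulmx0.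
  exact: eqxx.
have vE : v = r *: (v *m a^t*) by rewrite {1}Sv av scalemxAl.
have rc0 : Num.conj r != 0 by rewrite conjC_eq0.
have vta : a *m v^t* = (Num.conj r)^-1 *: v^t*.
  rewrite [in RHS]vE linearZ /= trmx_mul map_mxZ map_mxM trmxCK.
  by rewrite scalerA mulVf // scale1r.
have vt0 : v^t* != 0 by apply: contraNneq v0 => vt; rewrite -[v]trmxCK vt trmx0 map_mx0.
have := a_st _ (root_char_poly_eigen vta vt0).
rewrite normfV norm_conjC invf_lt1 ?normr_gt0 //.
by move=> /lt_trans/(_ r1); rewrite ltxx.
Qed.

(** The Stein operator is linear on a finite-dimensional space, so its injectivity
    also gives existence. *)
Lemma stein_unique_solution (F : numClosedFieldType) l (a B : 'M[F]_l) :
  a \in unitmx -> schur_stable a ->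
  exists! X : 'M[F]_l, X - a *m X *m a^t* = B.
Proof.
move=> a_u a_st.
pose T := 1%:M - lin_mx (mulmx a) *m lin_mx (mulmxr (a^t*)).
have TE X : mxvec X *m T = mxvec (X - a *m X *m a^t*).
  by rewrite mulmxBr mulmx1 mulmxA !mul_vec_lin raddfB.
have T_u : T \in unitmx.
  rewrite -row_free_unit -kermx_eq0; apply/eqP/row_matrixP => i; rewrite row0.
  have := row_sub i (kermx T); set y := row i _ => /sub_kermxP yT.
  rewrite -[y]vec_mxK; have -> : vec_mx y = 0 :> 'M[F]_l; last by rewrite raddf0.
  apply: stein_homogeneous a_u a_st _; apply/eqP; rewrite -subr_eq0.
  by rewrite -(can_eq mxvecK) -TE vec_mxK yT raddf0.
exists (vec_mx (mxvec B *m invmx T)); split=> [|X <-].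
  by apply: (can_inj mxvecK); rewrite -TE vec_mxK mulmxKV.
by rewrite -TE mulmxK // mxvecK.
Qed.

Variable K : realType.
Local Notation C := K[i].

Lemma le_geometric_eq0 (x M e : C) : 0 <= x < 1 -> 0 <= e ->
  (forall k, e <= x ^+ k * M) -> e = 0.
Proof.
case: x => x xi; case: e => e ei; case: M => M Mi.
rewrite lecE ltcE /= => /andP[/andP[/eqP-> x0] /andP[_ x1]].
rewrite lecE /= => /andP[/eqP-> e0] eM.
have xk k : (x +i* 0) ^+ k = (x ^+ k)%:C by rewrite -[x +i* 0]/(x%:C) rmorphXn.
have {}eM k : e <= x ^+ k * M.
  by have := eM k; rewrite xk lecE /= !mul0r subr0 => /andP[].
suff -> : e = 0 by [].
apply/le_anti; rewrite e0 andbT.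
have x1' : `|x| < 1 by rewrite ger0_norm.
have xM : ((fun k => x ^+ k * M) @ \oo --> (0 * M : K))%classic.
  by apply: cvgMl; apply: cvg_expr.
by rewrite -(mul0r M); apply: (cvgr_to_ge xM); apply: nearW.
Qed.

(** The starting points of bounded backward orbits form a space stable under a.
    An eigenmatrix v in it, with eigenvalue r, has a bounded orbit G with
    v = r^k G k for every k, so v = 0 because r lies in the open disk. *)
Lemma bounded_backward_orbit l n (a : 'M[C]_l) (H : nat -> 'M[C]_(l, n)) :
  a \in unitmx -> schur_stable a -> (forall k, H k = a *m H k.+1) ->
  (forall i j, exists M, forall k, `|H k i j| <= M) -> H 0 = 0.
Proof.
move=> a_u a_st Hrec Hbnd.
pose S u := exists G : nat -> 'M[C]_(l, n), [/\ G 0 = u, forall k, G k = a *m G k.+1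
  & forall i j, exists M, forall k, `|G k i j| <= M].
apply/eqP/negPn/negP => H0.
have [| |r [v [[G [G0 Grec Gbnd]] v0 av]]] := @stable_has_eigenmatrix _ _ _ a S (H 0) _ _ H0.
- move=> r v [G [G0 Grec Gbnd]]; exists (fun k => a *m G k - r *: G k).
  split=> [|k|i j]; first by rewrite G0.
    by rewrite mulmxBr -scalemxAr -Grec.
  have /choice[M Mb] : forall t, exists M, forall k, `|G k t j| <= M by move=> t.
  exists (\sum_t `|a i t| * M t + `|r| * M i) => k; rewrite !mxE.
  rewrite (le_trans (ler_normB _ _)) // normrM lerD ?ler_wpM2l //.
  rewrite (le_trans (ler_norm_sum _ _ _)) // ler_sum // => t _.
  by rewrite normrM ler_wpM2l.
- by exists H.
have r1 := a_st _ (root_char_poly_eigen av v0).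
have aG k : a *m G k = r *: G k.
  elim: k => [|k IH]; first by rewrite G0.
  apply: (row_full_inj (A := a)); rewrite ?row_full_unit //=.
  by rewrite -Grec IH -scalemxAr -Grec.
have vG k : v = r ^+ k *: G k.
  elim: k => [|k IH]; first by rewrite scale1r.
  by rewrite {1}IH Grec aG scalerA exprSr.
case/eqP: v0; apply/matrixP => i j; rewrite [RHS]mxE.
apply/eqP; rewrite -normr_eq0; apply/eqP.
have [M Mb] := Gbnd i j.
apply: (@le_geometric_eq0 `|r| M) => //.
  by rewrite normr_ge0.
by move=> k; rewrite (vG k) mxE normrM normrX ler_wpM2l.
Qed.

End EigenMatrices.

(** * Means of complex functions over the unit circle *)

Section ComplexFunctions.
Variable K : realType.
Local Notation C := K[i].
Local Notation Re := complex.Re.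
Local Notation Im := complex.Im.
Implicit Types (f g : K -> C).

(** Continuity is stated on real and imaginary parts, the functions that
    cintegral integrates. *)
Definition ccontinuous f :=
  continuous (fun t => Re (f t)) /\ continuous (fun t => Im (f t)).

Lemma ReD (x y : C) : Re (x + y) = Re x + Re y. Proof. by case: x y => ? ? []. Qed.
Lemma ImD (x y : C) : Im (x + y) = Im x + Im y. Proof. by case: x y => ? ? []. Qed.
Lemma ReM (x y : C) : Re (x * y) = Re x * Re y - Im x * Im y.
Proof. by case: x y => ? ? []. Qed.
Lemma ImM (x y : C) : Im (x * y) = Re x * Im y + Im x * Re y.
Proof. by case: x y => ? ? []. Qed.

Lemma ccontinuous_cst (c : C) : ccontinuous (fun=> c).
Proof. by split=> t; apply: cvg_cst. Qed.

Lemma ccontinuousD f g : ccontinuous f -> ccontinuous g ->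
  ccontinuous (fun t => f t + g t).
Proof.
move=> [fr fi] [gr gi]; split=> t.
  by under eq_fun do rewrite ReD; apply: cvgD; [apply: fr|apply: gr].
by under eq_fun do rewrite ImD; apply: cvgD; [apply: fi|apply: gi].
Qed.

Lemma ccontinuousM f g : ccontinuous f -> ccontinuous g ->
  ccontinuous (fun t => f t * g t).
Proof.
move=> [fr fi] [gr gi]; split=> t.
  under eq_fun do rewrite ReM; apply: cvgB; apply: cvgM;
    by [apply: fr|apply: gr|apply: fi|apply: gi].
under eq_fun do rewrite ImM; apply: cvgD; apply: cvgM;
  by [apply: fr|apply: gr|apply: fi|apply: gi].
Qed.

Lemma ccontinuousV f : (forall t, f t != 0) -> ccontinuous f ->
  ccontinuous (fun t => (f t)^-1).
Proof.
move=> f0 [fr fi].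
have n0 t : Re (f t) ^+ 2 + Im (f t) ^+ 2 != 0.
  have := f0 t; rewrite -normr_eq0 -sqrf_eq0 -add_Re2_Im2.
  by apply: contraNneq => ->.
have nV t : ((fun s => (Re (f s) ^+ 2 + Im (f s) ^+ 2)^-1) @ t -->
    (Re (f t) ^+ 2 + Im (f t) ^+ 2)^-1)%classic.
  apply: cvgV => //; apply: cvgD; rewrite expr2; under eq_fun do rewrite expr2.
    by apply: cvgM; apply: fr.
  by apply: cvgM; apply: fi.
have E t : (f t)^-1 = (Re (f t) / (Re (f t) ^+ 2 + Im (f t) ^+ 2)) +i*
    (- (Im (f t) / (Re (f t) ^+ 2 + Im (f t) ^+ 2))).
  by case: (f t) => x y.
split=> t.
  by under eq_fun do rewrite E /=; apply: cvgM; [apply: fr|apply: nV].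
under eq_fun do rewrite E /=; apply: cvgN; apply: cvgM.
  exact: fi.
exact: nV.
Qed.

Lemma ccontinuous_conj f : ccontinuous f -> ccontinuous (fun t => (f t)^*).
Proof.
move=> [fr fi]; split=> t.
  have -> : (fun t => Re (f t)^*) = (fun t => Re (f t)) by apply/funext => s; case: (f s).
  exact: fr.
have -> : (fun t => Im (f t)^*) = (fun t => - Im (f t)) by apply/funext => s; case: (f s).
by apply: cvgN; apply: fi.
Qed.

Lemma ccontinuous_sum (I : finType) (f : I -> K -> C) :
  (forall i, ccontinuous (f i)) -> ccontinuous (fun t => \sum_i f i t).
Proof.
move=> fc; rewrite (_ : (fun t => _) = \sum_i f i); last first.
  by apply/funext => t; rewrite fct_sumE.
apply: big_ind => [|f1 g1 ? ?|//]; first exact: ccontinuous_cst.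
exact: ccontinuousD.
Qed.

Lemma ccontinuousX f k : ccontinuous f -> ccontinuous (fun t => f t ^+ k).
Proof.
move=> fc; elim: k => [|k IH].
  by under eq_fun do rewrite expr0; apply: ccontinuous_cst.
by under eq_fun do rewrite exprS; apply: ccontinuousM.
Qed.

Lemma ccontinuous_horner (p : {poly C}) f : ccontinuous f ->
  ccontinuous (fun t => p.[f t]).
Proof.
move=> fc; under eq_fun do rewrite horner_coef.
apply: ccontinuous_sum => i; apply: ccontinuousM; first exact: ccontinuous_cst.
exact: ccontinuousX.
Qed.

Lemma ccontinuous_cexpi : ccontinuous (@cexpi K).
Proof. by split=> t /=; [apply: continuous_cos|apply: continuous_sin]. Qed.

Lemma cexpi_norm (t : K) : `|cexpi t| = 1.
Proof. by rewrite normc_def /= cos2Dsin2 sqrtr1. Qed.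

Lemma cexpiN (t : K) : cexpi (- t) = (cexpi t)^*.
Proof. by rewrite /cexpi cosN sinN. Qed.

Lemma cexpi_neq0 (t : K) : cexpi t != 0.
Proof. by rewrite -normr_eq0 cexpi_norm oner_eq0. Qed.

Lemma cexpiNV (t : K) : cexpi (- t) = (cexpi t)^-1.
Proof. by rewrite cexpiN invc_norm cexpi_norm expr1n invr1 mul1r. Qed.

Lemma cexpiD (s t : K) : cexpi (s + t) = cexpi s * cexpi t.
Proof.
rewrite /cexpi cosD sinD; apply/eqP; rewrite eq_complex /= eqxx /=.
by rewrite addrC.
Qed.

Lemma cexpiX (t : K) k : cexpi t ^+ k = cexpi (k%:R * t).
Proof.
elim: k => [|k IH]; first by rewrite expr0 mul0r /cexpi cos0 sin0.
by rewrite exprS IH -cexpiD -natr1 mulrDl mul1r addrC.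
Qed.

Definition cmean f : C := ((2 * pi)^-1)%:C * cintegral 0 (2 * pi) f.

Lemma continuous_integrable (f : K -> K) : continuous f ->
  (@lebesgue_measure K).-integrable `[0, 2 * pi]%classic (EFin \o f).
Proof.
move=> fc; apply: continuous_compact_integrable; first exact: segment_compact.
exact: continuous_subspaceT.
Qed.

Lemma eq_cmean f g : f =1 g -> cmean f = cmean g.
Proof. by move=> /funext ->. Qed.

Lemma cmeanD f g : ccontinuous f -> ccontinuous g ->
  cmean (fun t => f t + g t) = cmean f + cmean g.
Proof.
move=> [fr fi] [gr gi]; rewrite /cmean -mulrDr; congr (_ * _); rewrite /cintegral.
under eq_Rintegral do rewrite ReD.
under [X in _ +i* X]eq_Rintegral do rewrite ImD.
by rewrite !RintegralD //; apply: continuous_integrable.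
Qed.

Lemma cmeanZ (c : C) f : ccontinuous f -> cmean (fun t => c * f t) = c * cmean f.
Proof.
move=> [fr fi]; rewrite /cmean mulrCA; congr (_ * _); rewrite /cintegral.
under eq_Rintegral do rewrite ReM.
under [X in _ +i* X]eq_Rintegral do rewrite ImM.
have cZ (r : K) (h : K -> K) : continuous h -> continuous (fun t => r * h t).
  by move=> hc t; apply: cvgM; [apply: cvg_cst|apply: hc].
rewrite RintegralB //; try by apply: continuous_integrable; apply: cZ.
rewrite RintegralD //; try by apply: continuous_integrable; apply: cZ.
rewrite !RintegralZl //; try exact: continuous_integrable.
by case: c.
Qed.

Lemma cmean_sum (I : finType) (f : I -> K -> C) :
  (forall i, ccontinuous (f i)) ->
  cmean (fun t => \sum_i f i t) = \sum_i cmean (f i).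
Proof.
move=> fc; rewrite (_ : (fun t => _) = \sum_i f i); last first.
  by apply/funext => t; rewrite fct_sumE.
suff [] : ccontinuous (\sum_i f i) /\ cmean (\sum_i f i) = \sum_i cmean (f i) by [].
apply: (big_ind2 (fun g x => ccontinuous g /\ cmean g = x)) => [|g1 x1 g2 x2|i _ //].
  split; first exact: ccontinuous_cst.
  transitivity (0 * cmean (fun=> 0)); last by rewrite mul0r.
  rewrite -cmeanZ; last exact: ccontinuous_cst.
  by apply: eq_cmean => t; rewrite mul0r.
move=> [c1 <-] [c2 <-]; split; first exact: ccontinuousD.
exact: cmeanD.
Qed.

Lemma cmean_conj f : ccontinuous f -> cmean (fun t => (f t)^*) = (cmean f)^*.
Proof.
move=> [fr fi]; rewrite /cmean rmorphM /= oppr0 /cintegral; congr (_ * _).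
rewrite /=; congr (_ +i* _).
  by apply: eq_Rintegral => t _; case: (f t).
transitivity (\int[lebesgue_measure]_(x in `[0%R, (2 * pi)%R]) (-1 * Im (f x))).
  by apply: eq_Rintegral => t _; case: (f t) => x y; rewrite mulN1r.
by rewrite RintegralZl ?mulN1r //; apply: continuous_integrable.
Qed.

Lemma Rintegral_is_derive (F f : K -> K) : continuous f ->
  (forall t : K, is_derive t 1 F (f t)) ->
  \int[lebesgue_measure]_(t in `[0, 2 * pi]) f t = F (2 * pi) - F 0.
Proof.
move=> fc Ff; have Fd (t : K) : derivable F t 1 by have := Ff t; case.
have Fc : continuous F.
  by move=> t; apply/differentiable_continuous/derivable1_diffP.
have pi2 : 0 < 2 * pi :> K by rewrite mulr_gt0 ?pi_gt0.
rewrite /Rintegral (continuous_FTC2 pi2 (F := F)) //.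
- exact: continuous_subspaceT.
- split=> [t _ //||].
    by apply: cvg_at_right_filter; apply: Fc.
  by apply: cvg_at_left_filter; apply: Fc.
- by move=> t _; rewrite derive1E; apply: derive_val.
Qed.

Lemma cmean_cexpiX k : cmean (fun t => cexpi t ^+ k) = (k == 0)%:R.
Proof.
have pi0 : 2 * pi != 0 :> K by rewrite mulf_neq0 ?gt_eqF ?pi_gt0.
case: k => [|k] /=.
  have c1 (x : K) : continuous (fun _ : K => x) by move=> t; apply: cvg_cst.
  rewrite /cmean /cintegral /= (@Rintegral_is_derive id (fun=> 1) (c1 1)).
  rewrite (@Rintegral_is_derive (cst 0) (fun=> 0) (c1 0)).
  by rewrite !subr0 -[_ +i* 0]/(_%:C) -rmorphM /= mulVf.
set n : K := k.+1%:R; have n0 : n != 0 by rewrite pnatr_eq0.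
rewrite (eq_cmean (g := fun t => cexpi (n * t))) => [|t]; last by rewrite cexpiX.
rewrite /cmean /cintegral /=.
have nc : continuous (fun t : K => n * t).
  by move=> t; apply: cvgM; [apply: cvg_cst|apply: cvg_id].
have nd (t : K) : is_derive t 1 (fun t : K => n * t) n.
  have h : is_derive t 1 (n \*: @id K^o) (n *: 1) by apply: is_deriveZ.
  by apply: is_derive_eq h _; rewrite /GRing.scale /= mulr1.
have cosc : continuous (fun t : K => cos (n * t)).
  by move=> t; apply: continuous_comp; [apply: nc|apply: continuous_cos].
have sinc : continuous (fun t : K => sin (n * t)).
  by move=> t; apply: continuous_comp; [apply: nc|apply: continuous_sin].
have cosd (t : K) : is_derive t 1 (fun t => n^-1 * sin (n * t)) (cos (n * t)).
  have h : is_derive t 1 (sin \o (fun t : K => n * t)) (cos (n * t) * n).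
    exact: is_derive1_comp.
  have h2 := is_deriveZ n^-1 h.
  by apply: is_derive_eq h2 _; rewrite /GRing.scale /= mulrCA mulVf ?mulr1.
have sind (t : K) : is_derive t 1 (fun t => - n^-1 * cos (n * t)) (sin (n * t)).
  have h : is_derive t 1 (cos \o (fun t : K => n * t)) (- sin (n * t) * n).
    exact: is_derive1_comp.
  have h2 := is_deriveZ (- n^-1) h.
  apply: is_derive_eq h2 _.
  by rewrite /GRing.scale /=; field.
rewrite (Rintegral_is_derive cosc cosd) (Rintegral_is_derive sinc sind).
have : cexpi (n * (2 * pi)) = 1 :> C.
  by rewrite /n -cexpiX mulr_natl /cexpi cos2pi sin2pi expr1n.
rewrite /cexpi => -[-> ->]; rewrite !mulr0 cos0 sin0 !mulr0 subrr.
by rewrite subrr mulr0.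
Qed.

(** One bound serves all unimodular factors g, in particular all the powers of
    cexpi (- t) at once. *)
Lemma cmean_bounded f : ccontinuous f -> exists M : C,
  forall g, ccontinuous g -> (forall t, `|g t| = 1) ->
    `|cmean (fun t => g t * f t)| <= M.
Proof.
move=> fc; pose h t := Num.sqrt (Re (f t) ^+ 2 + Im (f t) ^+ 2).
pose I := \int[lebesgue_measure]_(t in `[0, 2 * pi]) h t.
have hc : continuous h.
  have [fr fi] := fc; move=> t; rewrite /h.
  apply: (@continuous_comp _ _ _ (fun t => Re (f t) ^+ 2 + Im (f t) ^+ 2)
    Num.sqrt); last exact: sqrt_continuous.
  apply: cvgD; rewrite expr2; under eq_fun do rewrite expr2.
    by apply: cvgM; apply: fr.
  by apply: cvgM; apply: fi.
exists (`|((2 * pi)^-1)%:C| * (I + I)%:C).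
move=> g gc g1; rewrite normrM ler_wpM2l //.
have [pr pi_] := ccontinuousM gc fc.
have gf t : `|g t * f t| = (h t)%:C by rewrite normrM g1 mul1r normc_def.
have bound (u : K -> K) : continuous u -> (forall t, `|u t| <= h t) ->
    `|\int[lebesgue_measure]_(t in `[0, 2 * pi]) u t| <= I.
  move=> uc uh; apply: le_trans (le_normr_Rintegral _ _) _ => //.
    exact: continuous_integrable.
  apply: le_Rintegral => //; try exact: continuous_integrable.
  apply: (@continuous_integrable (fun t => `|u t|)) => t.
  by apply: cvg_norm; apply: uc.
have cnorm (z : C) : `|z| <= (`|Re z| + `|Im z|)%:C.
  rewrite {1}(complexE z) rmorphD /= (le_trans (ler_normD _ _)) // normrM.
  rewrite [`|'i%C|]normc_def /= expr0n expr1n add0r sqrtr1 mul1r.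
  by rewrite !normc_def /= !expr0n /= !addr0 !sqrtr_sqr.
rewrite (le_trans (cnorm _)) // lecR; apply: lerD; apply: bound => // t.
  by rewrite -lecR -gf normc_ge_Re.
rewrite -lecR -gf; move: (g t * f t) => z.
have -> : Im z = - Re (z * 'i%C) by case: z => x y /=; rewrite mulr0 mulr1 sub0r opprK.
rewrite normrN; apply: le_trans (normc_ge_Re _) _; rewrite normrM.
by rewrite [`|'i%C|]normc_def /= expr0n expr1n add0r sqrtr1 mulr1.
Qed.

End ComplexFunctions.

(** * The spectral density on the unit circle *)

Section CircleIdentity.
Variables (F : numClosedFieldType) (l p : nat).
Implicit Types (a X : 'M[F]_l) (b : 'M[F]_(l, p)) (c : 'M[F]_(p, l)) (d : 'M[F]_p).

Lemma invmx_trmxC a : (invmx a)^t* = invmx (a^t*).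
Proof. by rewrite trmx_inv map_invmx. Qed.

Lemma sub_scalar_trmxC (z : F) a : (z%:M - a)^t* = (Num.conj z)%:M - a^t*.
Proof. by rewrite linearB /= tr_scalar_mx map_mxB map_scalar_mx. Qed.

(** With E = z - a and z of modulus 1, the Stein equation reads
    b b^* = E X E^* + E X a^* + a X E^*, so that
    G b b^* G^* = X + X a^* G^* + G a X: no product of two resolvents is left. *)
Lemma circle_spectral_identity a b c d X z :
  X - a *m X *m a^t* = b *m b^t* -> z * Num.conj z = 1 -> z%:M - a \in unitmx ->
  let G := invmx (z%:M - a) in
  (d + c *m G *m b) *m (d + c *m G *m b)^t* =
    (d *m d^t* + c *m X *m c^t*)
    + (d *m b^t* + c *m X *m a^t*) *m G^t* *m c^t*
    + c *m G *m (b *m d^t* + a *m X *m c^t*).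
Proof.
move=> stein zz E_u G.
set E := z%:M - a in E_u G *; set Es := (Num.conj z)%:M - a^t*.
have EsE : E^t* = Es by apply: sub_scalar_trmxC.
have Es_u : Es \in unitmx by rewrite -EsE map_unitmx unitmx_tr.
have GsE : G^t* = invmx Es by rewrite invmx_trmxC EsE.
have bbE : b *m b^t* = E *m X *m Es + E *m X *m a^t* + a *m X *m Es.
  rewrite -stein /E /Es !mulmxBl !mulmxBr !mul_scalar_mx !mul_mx_scalar.
  rewrite scalerA [Num.conj z * z]mulrC zz scale1r -!scalemxAl.
  set u := Num.conj z *: _; set v := z *: _; set x := a *m X *m _.
  by rewrite [RHS](_ : _ = X - x) //; apply/matrixP => i j; rewrite !mxE; ring.
have GE : G *m E = 1%:M by rewrite mulVmx.
have EsG : Es *m invmx Es = 1%:M by rewrite mulmxV.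
clearbody G Es E.
have key : G *m (b *m b^t*) *m G^t* = X + X *m a^t* *m G^t* + G *m a *m X.
  rewrite bbE GsE !mulmxDr !mulmxDl !mulmxA GE !mul1mx.
  by rewrite -[X *m Es *m _]mulmxA -[_ *m Es *m _]mulmxA EsG !mulmx1.
rewrite !linearD /= map_mxD !trmx_mul !map_mxM /=.
rewrite !mulmxDr !mulmxDl.
have -> : c *m G *m b *m (b^t* *m (G^t* *m c^t*)) =
    c *m (G *m (b *m b^t*) *m G^t*) *m c^t* by rewrite !mulmxA.
rewrite key !mulmxDr !mulmxDl !mulmxA.
move: (d *m d^t*) (c *m G *m b *m d^t*) (d *m b^t* *m G^t* *m c^t*).
move: (c *m X *m c^t*) (c *m X *m a^t* *m G^t* *m c^t*) (c *m G *m a *m X *m c^t*).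
by move=> *; apply/matrixP => i j; rewrite !mxE; ring.
Qed.

End CircleIdentity.

Section BoundaryAlgebra.
Variables (F : fieldType) (l p : nat).

Lemma scaler_sandwich (x : F) (M A D : 'M[F]_p) (c : 'M[F]_(p, l))
    (b : 'M[F]_(l, p)) (c' : 'M[F]_(p, l)) (b' : 'M[F]_(l, p)) (G G' : 'M[F]_l) :
  x *: (M + c *m G *m b + c' *m G' *m b') =
  x *: M + c *m (x *: G) *m b + c' *m (x *: G') *m b'.
Proof. by rewrite !scalerDr -!scalemxAr -!scalemxAl. Qed.

(** Here e stands for a^* and s for (-y)^m; the point is that V commutes with e,
    which lets the factor e of c X e cancel the inverse of e. *)
Lemma affine_boundary_terms (e X : 'M[F]_l) (b c' : 'M[F]_(l, p))
    (c b' : 'M[F]_(p, l)) (d d' : 'M[F]_p) (x y s : F) m :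
  e \in unitmx -> let V := x *: e - y%:M in
  s *: (d *m d' + c *m X *m c')
    + (d *m b' + c *m X *m e) *m ((V ^+ m - s%:M) *m invmx e) *m c' =
  s *: (d *m (d' - b' *m invmx e *m c'))
    + (d *m b' *m invmx e + c *m X) *m V ^+ m *m c'.
Proof.
move=> e_u V.
have eV : e *m V = V *m e.
  by rewrite mulmxBr mulmxBl -scalemxAl -scalemxAr scalar_mxC.
have eVm : e *m V ^+ m = V ^+ m *m e by apply: (commrX m eV).
have VN : (V ^+ m - s%:M) *m invmx e = invmx e *m (V ^+ m - s%:M).
  apply: (row_free_inj (A := e)); rewrite ?row_free_unit //=.
  rewrite mulmxKV // -mulmxA mulmxBl -eVm -scalar_mxC -mulmxBr mulKmx //.
move: (V ^+ m) VN => U VN.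
have -> : (d *m b' + c *m X *m e) *m ((U - s%:M) *m invmx e) =
    (d *m b' *m invmx e + c *m X) *m (U - s%:M).
  by rewrite VN mulmxA mulmxDl mulmxK.
rewrite !mulmxBr mulmxBl mul_mx_scalar -scalemxAl mulmxDl.
rewrite !mulmxA !scalerDr scalerN.
set u := (_ + c *m X *m U) *m c'.
rewrite [(_ + c *m X) *m c']mulmxDl scalerDr opprD; clearbody u.
move: (s *: (d *m d')) (s *: (c *m X *m c')) (s *: (_ *m invmx e *m c')).
by move=> A B C; apply/matrixP => i j; rewrite !mxE; ring.
Qed.

End BoundaryAlgebra.

(** * Means of resolvents over the unit circle *)

Section MatrixMean.
Variable K : realType.
Local Notation C := K[i].

Definition mxcontinuous m n (F : K -> 'M[C]_(m, n)) :=
  forall i j, ccontinuous (fun t => F t i j).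
Definition mxmean m n (F : K -> 'M[C]_(m, n)) : 'M[C]_(m, n) :=
  \matrix_(i, j) cmean (fun t => F t i j).

Lemma eq_mxmean m n (F G : K -> 'M[C]_(m, n)) : F =1 G -> mxmean F = mxmean G.
Proof. by move=> /funext ->. Qed.

Lemma mxcontinuous_cst m n (A : 'M[C]_(m, n)) : mxcontinuous (fun=> A).
Proof. by move=> i j; apply: ccontinuous_cst. Qed.

Lemma mxcontinuousD m n (F G : K -> 'M[C]_(m, n)) :
  mxcontinuous F -> mxcontinuous G -> mxcontinuous (fun t => F t + G t).
Proof.
by move=> Fc Gc i j; under eq_fun do rewrite mxE; apply: ccontinuousD.
Qed.

Lemma mxcontinuousZ m n (f : K -> C) (F : K -> 'M[C]_(m, n)) :
  ccontinuous f -> mxcontinuous F -> mxcontinuous (fun t => f t *: F t).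
Proof.
by move=> fc Fc i j; under eq_fun do rewrite mxE; apply: ccontinuousM.
Qed.

Lemma mxcontinuousM m n p (F : K -> 'M[C]_(m, n)) (G : K -> 'M[C]_(n, p)) :
  mxcontinuous F -> mxcontinuous G -> mxcontinuous (fun t => F t *m G t).
Proof.
move=> Fc Gc i j; under eq_fun do rewrite mxE; apply: ccontinuous_sum => k.
exact: ccontinuousM.
Qed.

Lemma mxmeanD m n (F G : K -> 'M[C]_(m, n)) :
  mxcontinuous F -> mxcontinuous G ->
  mxmean (fun t => F t + G t) = mxmean F + mxmean G.
Proof.
move=> Fc Gc; apply/matrixP => i j; rewrite !mxE -cmeanD //.
by apply: eq_cmean => t; rewrite mxE.
Qed.

Lemma mxmeanMl m n p (A : 'M[C]_(m, n)) (F : K -> 'M[C]_(n, p)) :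
  mxcontinuous F -> mxmean (fun t => A *m F t) = A *m mxmean F.
Proof.
move=> Fc; apply/matrixP => i j; rewrite !mxE.
rewrite (eq_cmean (g := fun t => \sum_k A i k * F t k j)) => [|t]; last by rewrite mxE.
rewrite cmean_sum => [|k]; last by apply: ccontinuousM => //; apply: ccontinuous_cst.
by apply: eq_bigr => k _; rewrite mxE cmeanZ.
Qed.

Lemma mxmeanMr m n p (A : 'M[C]_(n, p)) (F : K -> 'M[C]_(m, n)) :
  mxcontinuous F -> mxmean (fun t => F t *m A) = mxmean F *m A.
Proof.
move=> Fc; apply/matrixP => i j; rewrite !mxE.
rewrite (eq_cmean (g := fun t => \sum_k A k j * F t i k)) => [|t]; last first.
  by rewrite mxE; apply: eq_bigr => k _; rewrite mulrC.
rewrite cmean_sum => [|k]; last by apply: ccontinuousM => //; apply: ccontinuous_cst.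
by apply: eq_bigr => k _; rewrite mxE cmeanZ // mulrC.
Qed.

Lemma mxmeanZ m n (x : C) (F : K -> 'M[C]_(m, n)) :
  mxcontinuous F -> mxmean (fun t => x *: F t) = x *: mxmean F.
Proof.
move=> Fc; apply/matrixP => i j; rewrite !mxE -cmeanZ //.
by apply: eq_cmean => t; rewrite mxE.
Qed.

Lemma mxmean_scalar m n (f : K -> C) (A : 'M[C]_(m, n)) : ccontinuous f ->
  mxmean (fun t => f t *: A) = cmean f *: A.
Proof.
move=> fc; apply/matrixP => i j; rewrite !mxE mulrC -cmeanZ //.
by apply: eq_cmean => t; rewrite mxE mulrC.
Qed.

Lemma mxmean_trmxC m n (F : K -> 'M[C]_(m, n)) : mxcontinuous F ->
  mxcontinuous (fun t => (F t)^t*) /\ mxmean (fun t => (F t)^t*) = (mxmean F)^t*.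
Proof.
move=> Fc; split=> [i j|].
  by under eq_fun do rewrite !mxE; apply: ccontinuous_conj; apply: Fc.
apply/matrixP => i j; rewrite !mxE -[Num.conj _]/((cmean _)^*) -cmean_conj //.
by apply: eq_cmean => t; rewrite !mxE.
Qed.

End MatrixMean.

Section CircleMeans.
Variable K : realType.
Local Notation C := K[i].
Local Notation zeta t := (cexpi (- t)).

Lemma ccontinuous_rf_eval (f : ratfun C) :
  (forall t, rf_analytic f (cexpi t)) -> ccontinuous (fun t => rf_eval f (cexpi t)).
Proof.
move=> fc; apply: ccontinuousM; first exact/ccontinuous_horner/ccontinuous_cexpi.
by apply: ccontinuousV => //; exact/ccontinuous_horner/ccontinuous_cexpi.
Qed.

Lemma ccontinuous_zeta : ccontinuous (fun t : K => zeta t).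
Proof.
under eq_fun do rewrite cexpiN.
exact/ccontinuous_conj/ccontinuous_cexpi.
Qed.

Lemma cmean_zetaX k : cmean (fun t : K => zeta t ^+ k) = (k == 0)%:R.
Proof.
rewrite (eq_cmean (g := fun t => (cexpi t ^+ k)^*)) => [|t].
  rewrite cmean_conj; last exact/ccontinuousX/ccontinuous_cexpi.
  by rewrite cmean_cexpiX rmorph_nat.
by rewrite cexpiN rmorphXn.
Qed.

Lemma ccontinuous_affine (x y : C) m : ccontinuous (fun t => (x * zeta t - y) ^+ m).
Proof.
apply: ccontinuousX; apply: ccontinuousD; last exact: ccontinuous_cst.
by apply: ccontinuousM; [apply: ccontinuous_cst | apply: ccontinuous_zeta].
Qed.

(** The factor zeta^k strengthens the induction: one more factor x zeta - y
    raises k by one in the first of the two terms that it produces. *)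
Lemma cmean_affineX (x y : C) m k :
  cmean (fun t => (x * zeta t - y) ^+ m * zeta t ^+ k) = (- y) ^+ m * (k == 0)%:R.
Proof.
elim: m k => [|m IH] k.
  by rewrite mul1r -cmean_zetaX; apply: eq_cmean => t; rewrite mul1r.
have ck j : ccontinuous (fun t => (x * zeta t - y) ^+ m * zeta t ^+ j).
  by apply: ccontinuousM; [apply: ccontinuous_affine|apply/ccontinuousX/ccontinuous_zeta].
rewrite (eq_cmean (g := fun t => x * ((x * zeta t - y) ^+ m * zeta t ^+ k.+1)
  + (- y) * ((x * zeta t - y) ^+ m * zeta t ^+ k))) => [|t]; last first.
  by rewrite !exprS; ring.
rewrite cmeanD; try by apply: ccontinuousM => //; apply: ccontinuous_cst.
by rewrite !cmeanZ // !IH mulr0 mulr0 add0r mulrA -exprS.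
Qed.

Variables (l : nat) (a : 'M[C]_l).
Hypothesis a_st : schur_stable a.
Local Notation G t := (invmx ((cexpi t)%:M - a)).

Lemma schur_stable_circle (t : K) : ~~ root (char_poly a) (cexpi t).
Proof. by apply/negP => /a_st; rewrite cexpi_norm ltxx. Qed.

Lemma circle_resolvent_unit (t : K) : (cexpi t)%:M - a \in unitmx.
Proof. by case: (mx_analytic_resolvent (schur_stable_circle t)). Qed.

Lemma mxcontinuous_resolvent : mxcontinuous (fun t => G t).
Proof.
move=> i j; rewrite (_ : (fun t => _) = fun t => rf_eval (resolvent a i j) (cexpi t)).
  apply: ccontinuous_rf_eval => t.
  by case: (mx_analytic_resolvent (schur_stable_circle t)).
apply/funext => t; case: (mx_analytic_resolvent (schur_stable_circle t)) => _ _ <-.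
by rewrite mxE.
Qed.

Hypothesis a_u : a \in unitmx.

(** With H j the mean of zeta^(k+j) G, the relation z G = 1 + a G gives
    H j = a H (j+1), as positive powers of zeta have mean 0. *)
Lemma mxmean_zetaX_resolvent k : mxmean (fun t => zeta t ^+ k *: G t) = 0.
Proof.
have cz j : ccontinuous (fun t : K => zeta t ^+ j) by apply/ccontinuousX/ccontinuous_zeta.
have cG j : mxcontinuous (fun t => zeta t ^+ j *: G t).
  by apply: mxcontinuousZ => //; apply: mxcontinuous_resolvent.
pose H j := mxmean (fun t => zeta t ^+ (k + j) *: G t).
rewrite -[LHS]/(mxmean _) (_ : mxmean _ = H 0); last by rewrite /H addn0.
apply: (bounded_backward_orbit a_u a_st) => [j|i j].
  rewrite /H -mxmeanMl //.
  rewrite (eq_mxmean (G := fun t => zeta t ^+ (k + j.+1) *: 1%:M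
     + a *m (zeta t ^+ (k + j.+1) *: G t))) => [|t].
    rewrite mxmeanD; last by apply: mxcontinuousM => //; apply: mxcontinuous_cst.
      by rewrite mxmean_scalar // cmean_zetaX addnS scale0r add0r.
    by apply: mxcontinuousZ => //; apply: mxcontinuous_cst.
  rewrite -scalemxAr -scalerDr addnS exprSr -scalerA; congr (_ *: _).
  have GE : G t = zeta t *: (1%:M + a *m G t).
    rewrite -(mulmxV (circle_resolvent_unit t)) -mulmxDl subrK mul_scalar_mx.
    by rewrite scalerA cexpiNV mulVf ?cexpi_neq0 // scale1r.
  exact: GE.
have [M Mb] := cmean_bounded (mxcontinuous_resolvent i j).
exists M => s; rewrite /H mxE.
rewrite (eq_cmean (g := fun t => zeta t ^+ (k + s) * G t i j)) => [|t]; last by rewrite mxE.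
by apply: Mb => // t; rewrite normrX cexpi_norm expr1n.
Qed.

Lemma mxmean_affine_resolvent (x y : C) m :
  mxmean (fun t => (x * zeta t - y) ^+ m *: G t) = 0.
Proof.
suff h k : mxmean (fun t => ((x * zeta t - y) ^+ m * zeta t ^+ k) *: G t) = 0.
  by rewrite -(h 0); apply: eq_mxmean => t; rewrite mulr1.
elim: m k => [|m IH] k.
  by rewrite -[RHS](mxmean_zetaX_resolvent k); apply: eq_mxmean => t; rewrite mul1r.
have ck j : mxcontinuous (fun t => ((x * zeta t - y) ^+ m * zeta t ^+ j) *: G t).
  apply: mxcontinuousZ mxcontinuous_resolvent; apply: ccontinuousM.
    exact: ccontinuous_affine.
  exact/ccontinuousX/ccontinuous_zeta.
rewrite (eq_mxmean (G := fun t => x *: (((x * zeta t - y) ^+ m * zeta t ^+ k.+1) *: G t)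
  + (- y) *: (((x * zeta t - y) ^+ m * zeta t ^+ k) *: G t))) => [|t]; last first.
  by rewrite !scalerA -scalerDl; congr (_ *: _); rewrite !exprS; ring.
rewrite mxmeanD; try by apply: mxcontinuousZ => //; apply: ccontinuous_cst.
by rewrite !mxmeanZ // !IH !scaler0 addr0.
Qed.

(** Induction on m: zeta G^* = 1 + a^* G^* turns one factor x zeta - y in front of
    G^* into x + V G^*. *)
Lemma mxmean_affine_resolvent_adj (x y : C) m :
  let V := x *: a^t* - y%:M in
  mxmean (fun t => (x * zeta t - y) ^+ m *: (G t)^t*) =
    (V ^+ m - ((- y) ^+ m)%:M) *m invmx (a^t*).
Proof.
move=> V; have [cGs mGs] := mxmean_trmxC mxcontinuous_resolvent.
have cG j : mxcontinuous (fun t => (x * zeta t - y) ^+ j *: (G t)^t*).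
  by apply: mxcontinuousZ => //; apply: ccontinuous_affine.
have as_u : a^t* \in unitmx by rewrite map_unitmx unitmx_tr.
elim: m => [|m IH].
  rewrite expr0 subrr mul0mx.
  rewrite (eq_mxmean (G := fun t => (G t)^t*)) => [|t]; last by rewrite scale1r.
  rewrite mGs (_ : mxmean _ = 0) ?trmx0 ?map_mx0 //.
  rewrite -(mxmean_zetaX_resolvent 0); apply: eq_mxmean => t.
  by rewrite scale1r.
rewrite (eq_mxmean (G := fun t => (x * zeta t - y) ^+ m *: x%:M
    + V *m ((x * zeta t - y) ^+ m *: (G t)^t*))) => [|t]; last first.
  rewrite exprSr -scalerA -scalemxAr -scalerDr; congr (_ *: _).
  have GE : zeta t *: (G t)^t* = 1%:M + a^t* *m (G t)^t*.
    rewrite invmx_trmxC sub_scalar_trmxC -[Num.conj _]/((cexpi t)^*) -cexpiN.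
    have z_u : (zeta t)%:M - a^t* \in unitmx.
      rewrite cexpiN -[(cexpi t)^*]/(Num.conj _) -sub_scalar_trmxC.
      by rewrite map_unitmx unitmx_tr circle_resolvent_unit.
    by rewrite -(mulmxV z_u) -mulmxDl subrK mul_scalar_mx.
  rewrite scalerBl -scalerA GE /V mulmxBl mul_scalar_mx -scalemxAl scalerDr.
  by rewrite scalemx1 addrA.
rewrite mxmeanD //; last by apply: mxcontinuousM => //; apply: mxcontinuous_cst.
  rewrite mxmeanMl // IH mxmean_scalar; last exact: ccontinuous_affine.
  have -> : cmean (fun t => (x * zeta t - y) ^+ m) = (- y) ^+ m.
    rewrite -[RHS]mulr1 -(cmean_affineX x y m 0).
    by apply: eq_cmean => t; rewrite mulr1.
  apply: (row_free_inj (A := a^t*)); rewrite ?row_free_unit //=.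
  rewrite mulmxDl !mulmxA !mulmxKV // mulmxBr -[V *m V ^+ m]/(V * V ^+ m) -exprS.
  rewrite -scalemxAl mul_scalar_mx mul_mx_scalar {2}/V scalerBr scale_scalar_mx.
  by rewrite addrCA opprB subrKC (exprSr (- y)) mulrN raddfN opprK.
by apply: mxcontinuousZ; [apply: ccontinuous_affine|apply: mxcontinuous_cst].
Qed.

End CircleMeans.

(** * Spectral factors on the unit circle *)

Section CirclePoles.
Variable K : realType.
Local Notation C := K[i].

(** An arc contains infinitely many points; those used here are indexed by the
    angles q / (k+1), at which cos is injective because q <= pi. *)
Lemma circle_arc_roots (B : {poly C}) (z0 : C) (e : K) : z0 != 0 -> 0 < e ->
  (forall t, `|t| < e -> root B (z0 * cexpi t)) -> B = 0.
Proof.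
move=> z0_n0 e0 Be; apply/eqP/negPn/negP => B0.
pose q : K := Num.min (e / 2) pi.
have q0 : 0 < q by rewrite lt_min divr_gt0 ?pi_gt0.
have qe : q < e by rewrite gt_min ltr_pdivrMr // ltr_pMr // ltr1n.
have qpi : q <= pi by rewrite ge_min lexx orbT.
pose t (k : nat) := q / k.+1%:R.
have t_gt0 k : 0 < t k by rewrite divr_gt0.
have t_le k : t k <= q by rewrite ler_pdivrMr //; apply: ler_peMr; rewrite ?ler1n ?ltW.
pose rs := [seq z0 * cexpi (t k) | k <- iota 0 (size B)].
have : (size rs < size B)%N.
  apply: max_poly_roots => //.
    apply/allP => _ /mapP[k _ ->]; apply: Be.
    by rewrite gtr0_norm // (le_lt_trans (t_le k)).
  rewrite map_inj_uniq ?iota_uniq // => j k /(mulfI z0_n0) [cos_eq _].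
  have tin i : t i \in `[0, pi].
    by rewrite in_itv /= ltW //= (le_trans (t_le i)).
  have := cos_inj (tin j) (tin k) cos_eq; rewrite /t.
  move=> /(mulfI (lt0r_neq0 q0))/invr_inj/eqP.
  by rewrite eqr_nat eqSS => /eqP.
by rewrite size_map size_iota ltnn.
Qed.

(** On the unit circle R is the Gram matrix of the rows of w, so each entry of w
    has its squared modulus bounded by a diagonal entry of R; a pole of w on the
    circle would make that bound fail on a whole arc. *)
Lemma spectral_factor_circle p (R w : 'M[ratfun C]_p) :
  (forall z : C, `|z| = 1 -> mx_analytic R z) -> left_spectral_factor R w ->
  forall z : C, `|z| = 1 -> mx_analytic w z.
Proof.
move=> R_circle [_ _ _ RE] z0 z01 i j; apply: contraT => wz0.
pose n := rf_num (w i j); pose e := rf_den (w i j).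
pose r := rf_num (R i i); pose s := rf_den (R i i).
have z0_n0 : z0 != 0 by rewrite -normr_eq0 z01 oner_eq0.
have ez0 : e.[z0] = 0 by apply/eqP; move: wz0; rewrite /rf_analytic negbK.
have nz0 : n.[z0] != 0.
  by have := rf_coprime (w i j); rewrite coprimep_sym => /coprimep_root; apply; apply/eqP.
have sz0 : s.[z0] != 0 by have := R_circle _ z01 i i.
pose B := \prod_k \prod_m rf_den (w k m).
have B0 : B != 0.
  by apply/prodf_neq0 => k _; apply/prodf_neq0 => m _; apply: rf_den_neq0.
have bound z : `|z| = 1 -> ~~ root B z ->
    `|n.[z]| ^+ 4 * `|s.[z]| ^+ 2 <= `|e.[z]| ^+ 4 * `|r.[z]| ^+ 2.
  move=> z1 Bz; have z_n0 : z != 0 by rewrite -normr_eq0 z1 oner_eq0.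
  have wz : mx_analytic w z.
    move=> k m; move: Bz; rewrite /rf_analytic rootE horner_prod.
    move=> /prodf_neq0/(_ k isT); rewrite horner_prod.
    by move=> /prodf_neq0/(_ m isT).
  have zV : (z^*)^-1 = z by rewrite -conjc_inv invc_norm z1 expr1n invr1 mul1r conjcK.
  have := RE z z_n0 (R_circle _ z1) wz; rewrite zV => /(_ wz) Rz.
  have Rii : `|rf_eval (w i j) z| ^+ 2 <= rf_eval (R i i) z.
    have -> : rf_eval (R i i) z = \sum_k `|rf_eval (w i k) z| ^+ 2.
      move/matrixP/(_ i i): Rz; rewrite !mxE => ->.
      by apply: eq_bigr => k _; rewrite !mxE normCK.
    by rewrite (bigD1 j) //= lerDl sumr_ge0 // => k _; rewrite exprn_ge0.
  have ez : e.[z] != 0 by apply: wz.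
  have sz : s.[z] != 0 by have := R_circle _ z1 i i.
  move: Rii; rewrite /rf_eval -/n -/e -/r -/s => Rii.
  have := le_trans Rii (real_ler_norm (ger0_real (le_trans (exprn_ge0 2 (normr_ge0 _)) Rii))).
  rewrite !normf_div expr_div_n ler_pdivrMr ?exprn_gt0 ?normr_gt0 //.
  rewrite mulrAC ler_pdivlMr ?normr_gt0 // => le1.
  have sq (x y : C) : x ^+ 4 * y ^+ 2 = (x ^+ 2 * y) ^+ 2 by ring.
  by rewrite !sq ler_sqr ?nnegrE ?mulr_ge0 ?exprn_ge0 // [X in _ <= X]mulrC.
(* Where P t > 0 the bound fails at z0 * cexpi t, so B vanishes there. As e
   vanishes at z0, P 0 > 0, and hence P > 0 on a whole arc. *)
pose sqn (q : {poly C}) (t : K) := q.[z0 * cexpi t] * (q.[z0 * cexpi t])^*.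
pose P (t : K) : K := complex.Re
  (sqn n t ^+ 2 * sqn s t - sqn e t ^+ 2 * sqn r t).
have Pc : continuous P.
  have hc (q : {poly C}) : ccontinuous (sqn q).
    have hq : ccontinuous (fun t => q.[z0 * cexpi t]).
      apply/ccontinuous_horner/ccontinuousM; first exact: ccontinuous_cst.
      exact: ccontinuous_cexpi.
    by apply: ccontinuousM => //; apply: ccontinuous_conj.
  have [] // : ccontinuous (fun t =>
      sqn n t ^+ 2 * sqn s t + (-1) * (sqn e t ^+ 2 * sqn r t)).
    apply: ccontinuousD; first by apply: ccontinuousM => //; apply: ccontinuousX.
    apply: ccontinuousM; first exact: ccontinuous_cst.
    by apply: ccontinuousM => //; apply: ccontinuousX.
  by move=> + _; rewrite /P; under eq_fun do rewrite mulN1r.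
have P0 : 0 < P 0.
  have : 0 < `|n.[z0]| ^+ 4 * `|s.[z0]| ^+ 2 :> C.
    by rewrite mulr_gt0 ?exprn_gt0 ?normr_gt0.
  rewrite /P /sqn /cexpi cos0 sin0 mulr1 ez0 mul0r expr0n mul0r subr0.
  by rewrite -!sqr_normc -exprM ltcE => /andP[].
have : \forall t \near (0 : K), 0 < P t by apply: cvgr_gt (Pc 0) _ P0.
move=> /nbhs_ballP[x /= x0 xP].
have B00 := @circle_arc_roots B z0 x z0_n0 x0.
move: B0; rewrite B00 ?eqxx // => t tx.
apply: contraT => Bt; have := bound (z0 * cexpi t).
rewrite normrM z01 cexpi_norm mulr1 => /(_ erefl Bt).
have := xP t; rewrite /ball /= sub0r normrN => /(_ tx).
rewrite /P /sqn -!sqr_normc -!exprM => + le1.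
by move: le1; rewrite -subr_le0 lecE => /andP[_ le1] /lt_le_trans/(_ le1); rewrite ltxx.
Qed.

End CirclePoles.

(** * Boundary values *)

Section BoundaryValues.
Variable K : realType.
Local Notation C := K[i].
Local Notation zeta t := (cexpi (- t)).

Lemma minimal_spectral_factor_stable p l (R w : 'M[ratfun C]_p) (a : 'M[C]_l) b c d :
  (forall z : C, `|z| = 1 -> mx_analytic R z) -> left_spectral_factor R w ->
  minimal_realization w a b c d -> schur_stable a.
Proof.
move=> R_circle w_factor w_min r ar.
have nowr : ~ mx_analytic w r by move=> /(minimal_realization_pole w_min); rewrite ar.
rewrite real_ltNge ?normr_real //; apply/negP; rewrite le_eqVlt => /orP[/eqP r1|r1].
  by apply: nowr; apply: (spectral_factor_circle R_circle w_factor).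
by have [_ _ /(_ r r1)[/nowr]] := w_factor.
Qed.

Lemma circle_spectral_density p l (R w : 'M[ratfun C]_p) (a : 'M[C]_l) b c d (t : K) :
  (forall z : C, `|z| = 1 -> mx_analytic R z) -> left_spectral_factor R w ->
  realization w a b c d -> schur_stable a ->
  let W := d + c *m invmx ((cexpi t)%:M - a) *m b in
  mx_eval R (cexpi t) = W *m W^t*.
Proof.
move=> R_circle w_factor real_w a_st W.
have z1 := cexpi_norm t; have wz := spectral_factor_circle R_circle w_factor z1.
have [_ _ _ /(_ _ (cexpi_neq0 t) (R_circle _ z1) wz)] := w_factor.
have -> : ((cexpi t)^*)^-1 = cexpi t.
  by transitivity (cexpi (- t))^-1; [rewrite cexpiN | rewrite cexpiNV invrK].
move=> /(_ wz) ->; suff -> : mx_eval w (cexpi t) = W by [].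
have [rz _ rE] := mx_analytic_resolvent (schur_stable_circle a_st t).
have [dz dE] := mx_analytic_const d (cexpi t).
have [cz cE] := mx_analytic_const c (cexpi t).
have [bz bE] := mx_analytic_const b (cexpi t).
have [crz crE] := mx_analyticM cz rz.
have [crbz crbE] := mx_analyticM crz bz.
have [_ E] := mx_analyticD dz crbz.
rewrite real_w -/(resolvent a) [LHS]E dE crbE bE crE cE rE.
by [].
Qed.

Lemma mxmean_affine_spectral p l (a X : 'M[C]_l) (b : 'M[C]_(l, p))
    (c : 'M[C]_(p, l)) (d : 'M[C]_p) (x y : C) m :
  a \in unitmx -> schur_stable a -> X - a *m X *m a^t* = b *m b^t* ->
  let V := x *: a^t* - y%:M in
  let W t := d + c *m invmx ((cexpi t)%:M - a) *m b in
  mxmean (fun t => (x * zeta t - y) ^+ m *: (W t *m (W t)^t*)) =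
    (- y) ^+ m *: (d *m (d^t* - b^t* *m invmx (a^t*) *m c^t*))
    + (d *m b^t* *m invmx (a^t*) + c *m X) *m V ^+ m *m c^t*.
Proof.
move=> a_u a_st stein V W.
pose s t := (x * zeta t - y) ^+ m.
pose M0 := d *m d^t* + c *m X *m c^t*.
pose A := d *m b^t* + c *m X *m a^t*; pose B := b *m d^t* + a *m X *m c^t*.
pose G t := invmx ((cexpi t)%:M - a).
have Gc : mxcontinuous G by apply: mxcontinuous_resolvent.
have sc : ccontinuous s by apply: ccontinuous_affine.
have sGc : mxcontinuous (fun t => s t *: G t) by apply: mxcontinuousZ.
have sGsc : mxcontinuous (fun t => s t *: (G t)^t*).
  by apply: mxcontinuousZ => //; apply: (mxmean_trmxC Gc).1.
have cstc u v (M : 'M[C]_(u, v)) := mxcontinuous_cst M.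
rewrite (eq_mxmean (G := fun t => s t *: M0 + A *m (s t *: (G t)^t*) *m c^t*
  + c *m (s t *: G t) *m B)) => [|t]; last first.
  have zz : cexpi t * Num.conj (cexpi t) = 1 by rewrite -normCK cexpi_norm expr1n.
  rewrite (circle_spectral_identity c d stein zz (circle_resolvent_unit a_st t)).
  exact: scaler_sandwich.
have AGc : mxcontinuous (fun t => A *m (s t *: (G t)^t*)) by apply: mxcontinuousM.
have cGc : mxcontinuous (fun t => c *m (s t *: G t)) by apply: mxcontinuousM.
have M0c : mxcontinuous (fun t => s t *: M0) by apply: mxcontinuousZ.
have AGcc : mxcontinuous (fun t => A *m (s t *: (G t)^t*) *m c^t*).
  by apply: mxcontinuousM.
rewrite mxmeanD; [|exact: mxcontinuousD|exact: mxcontinuousM].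
rewrite mxmeanD // mxmean_scalar // !mxmeanMr // !mxmeanMl //.
rewrite (mxmean_affine_resolvent a_st a_u) mulmx0 mul0mx addr0.
rewrite (mxmean_affine_resolvent_adj a_st a_u) -/V.
have -> : cmean s = (- y) ^+ m.
  rewrite -[RHS]mulr1 -(cmean_affineX x y m 0).
  by apply: eq_cmean => t; rewrite mulr1.
have as_u : a^t* \in unitmx by rewrite map_unitmx unitmx_tr.
exact: affine_boundary_terms.
Qed.

Lemma boundary_valueE p (R : 'M[ratfun C]_p) m :
  boundary_value R m = mxmean (fun t =>
    ((Num.sqrt 2)%:C * zeta t - 'i%R) ^+ m *: mx_eval R (cexpi t)).
Proof.
apply/matrixP => j k; rewrite [LHS]mxE [RHS]mxE; apply: eq_cmean => t.
by rewrite [RHS]mxE.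
Qed.

End BoundaryValues.

(* In the case d = c a^-1 b the source prints c (X a^-* + a^-1 X); this
   contradicts the general formula already for p = l = 1, a = 1/4, b = c = 1,
   d = 4, and the value given by the general formula and the Stein equation is
   c (a^-1 X a^-* ), which is what is stated here. *)
Theorem proposition5p3 (K : realType) (p l : nat)
  (R w : 'M[ratfun K[i]]_p)
  (a : 'M[K[i]]_l) (b : 'M[K[i]]_(l, p)) (c : 'M[K[i]]_(p, l)) (d : 'M[K[i]]_p)
  (R_infty : mx_analytic_infty R)
  (R_circle : forall z : K[i], `|z| = 1 ->
     mx_analytic R z /\ posdefmx (mx_eval R z))
  (w_factor : left_spectral_factor R w)
  (w_min : minimal_realization w a b c d)
  (a_unit : a \in unitmx) :
  (exists! X : 'M[K[i]]_l, stein_solution a b X) /\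
  forall X : 'M[K[i]]_l, stein_solution a b X ->
    let V := (Num.sqrt 2)%:C *: a^t* - 'i%:M in
    [/\ forall m : nat, boundary_value R m =
          (- 'i) ^+ m *: (d *m (d^t* - b^t* *m invmx (a^t*) *m c^t*))
          + (d *m b^t* *m invmx (a^t*) + c *m X) *m V ^+ m *m c^t*,
        d = 0 -> forall m : nat, boundary_value R m =
          c *m X *m V ^+ m *m c^t*
      & d = c *m invmx a *m b -> forall m : nat, boundary_value R m =
          c *m (invmx a *m X *m invmx (a^t*)) *m V ^+ m *m c^t* ].
Proof.
have Ran z : `|z| = 1 -> mx_analytic R z by move=> /R_circle[].
have a_st := minimal_spectral_factor_stable Ran w_factor w_min.
split; first exact: stein_unique_solution.
move=> X stein V.
have main m : boundary_value R m =
    (- 'i) ^+ m *: (d *m (d^t* - b^t* *m invmx (a^t*) *m c^t*))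
    + (d *m b^t* *m invmx (a^t*) + c *m X) *m V ^+ m *m c^t*.
  rewrite boundary_valueE -(mxmean_affine_spectral c d _ _ m a_unit a_st stein).
  apply: eq_mxmean => t; congr (_ *: _).
  exact: (circle_spectral_density t Ran w_factor w_min.1 a_st).
split=> // [d0 m|dE m].
  by rewrite main d0 !mul0mx scaler0 !add0r.
have as_u : a^t* \in unitmx by rewrite map_unitmx unitmx_tr.
have dsE : d^t* = b^t* *m invmx (a^t*) *m c^t*.
  by rewrite dE !trmx_mul !map_mxM invmx_trmxC mulmxA.
rewrite main dsE subrr mulmx0 scaler0 add0r; congr (_ *m _ *m _).
rewrite dE -!mulmxA -mulmxDr; congr (_ *m _).
rewrite !mulmxA -[_ *m b *m _]mulmxA -stein mulmxBr mulmxBl !mulmxA.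
by rewrite mulmxK // mulVmx // mul1mx subrK.
Qed.
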